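(* Let $(\mathcal{E},\otimes)$ be a locally subcartesian closed category, and let $e\colon S\to A$, $f\colon A\to E$, $p\colon E\to B$, $p'\colon S\to D$, $d\colon D\to B$ be morphisms such that the square $p\circ(fe)=d\circ p'$ is a subpullback. Then there is a canonical natural transformation $$\mathfrak{d}\colon\Sigma_d\boxtimes_{p'}\Delta_e\Rightarrow\boxtimes_p\Sigma_f\colon\mathcal{E}/A\to\mathcal{E}/B .$$ Moreover, $\mathfrak{d}$ is invertible if and only if the square (that is, the triple $(e,p',d)$) is a distributivity subpullback of $f$ along $p$.
   Context: A commuting square $fg'=gf'$ on a cospan $f\colon A\to X$, $g\colon B\to X$ is subcartesian if the pair $(g',f')$ is jointly monic. A locally subcartesian category $(\mathcal{E},\otimes)$ is a category $\mathcal{E}$ with, for each cospan $f\colon A\to X$, $g\colon B\to X$, a chosen subcartesian square with apex $A\otimes_X B$ and projections $g'\colon A\otimes_X B\to A$, $f'\colon A\otimes_X B\to B$, subject to: (symmetry) there are isomorphisms $A\otimes_X B\cong B\otimes_X A$ commuting with the projections; (nullary) if $g$ is an identity then so is $g'$; (binary) for $p\colon W\to Y$, $q\colon Y\to Z$, $g\colon B\to Z$, with $g'\colon Y\otimes_Z B\to Y$, pasting the chosen square of $(p,g')$ with the chosen square of $(q,g)$ gives a square isomorphic, compatibly with the projections to $W$ and $B$, to the chosen square of $(qp,g)$. A commuting square is called a subpullback if it is isomorphic, compatibly with projections, to the chosen square of its cospan. For $f\colon X\to Y$: $\Sigma_f\colon\mathcal{E}/X\to\mathcal{E}/Y$ is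 composition with $f$; $\Delta_f$ is pullback along $f$; $\nabla_f\colon\mathcal{E}/Y\to\mathcal{E}/X$ sends $h\colon H\to Y$ to the projection $X\otimes_Y H\to X$ (and acts on morphisms by the unique maps compatible with projections). Each slice $\mathcal{E}/X$ is monoidal with $f\otimes_X g=\Sigma_g\nabla_g(f)$. $(\mathcal{E},\otimes)$ is locally subcartesian closed if $\mathcal{E}$ has pullbacks and each of these monoidal structures is right closed; equivalently every $\nabla_p$ has a right adjoint $\boxtimes_p$. For $f\colon A\to E$ and $p\colon E\to B$, a distributivity subpullback of $f$ along $p$ is a triple $(e\colon S\to A,\ p'\colon S\to D,\ d\colon D\to B)$ such that the square $p\circ(fe)=d\circ p'$ is a subpullback, and which is terminal among such triples: given $(h\colon L\to A, s\colon L\to M, v\colon M\to B)$ with $p\circ(fh)=v\circ s$ a subpullback, there are unique $x\colon L\to S$, $y\colon M\to D$ with $ex=h$, $dy=v$, $p'x=ys$. The canonical transformation $\mathfrak{d}$ at $h\colon R\to A$: writing $m\colon M\to D$ for $\boxtimes_{p'}\Delta_e(h)$, the component $\mathfrak{d}_h$ is the adjunct under $\nabla_p\dashv\boxtimes_p$ of the composite $E\otimes_B M\cong S\otimes_D M\to S\times_A R\to R$ over $E$, where the isomorphism comes from pasting subpullbacks, the next map is the counit of $\nabla_{p'}\dashv\boxtimes_{p'}$ and the last map is the projection. *)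

(* Defs.v *)
(* Morphisms are compared by Leibniz equality; proof irrelevance is used only
   for the equality of morphisms in slice categories. *)
From Stdlib Require Import ssreflect ProofIrrelevance.

Set Implicit Arguments.
Unset Strict Implicit.
Unset Printing Implicit Defensive.

Declare Scope cat_scope.
Delimit Scope cat_scope with cat.
Open Scope cat_scope.

Reserved Notation "g ∘ f" (at level 40, left associativity).

Record Category : Type := {
  Ob :> Type;
  Hom : Ob -> Ob -> Type;
  idm : forall A, Hom A A;
  comp : forall A B C, Hom B C -> Hom A B -> Hom A C;
  comp1m : forall A B (f : Hom A B), comp (idm B) f = f;
  compm1 : forall A B (f : Hom A B), comp f (idm A) = f;
  compA : forall A B C D (h : Hom C D) (g : Hom B C) (f : Hom A B),
    comp h (comp g f) = comp (comp h g) f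
}.

Arguments Hom {c} A B.
Arguments idm {c} A.
Notation "g ∘ f" := (comp g f) : cat_scope.

Record Functor (C D : Category) : Type := {
  fob :> C -> D;
  fmap : forall A B : C, Hom A B -> Hom (fob A) (fob B);
  fmap1 : forall A : C, fmap (idm A) = idm (fob A);
  fmapM : forall (A B E : C) (g : Hom B E) (f : Hom A B),
    fmap (g ∘ f) = fmap g ∘ fmap f
}.

Arguments fmap {C D} F {A B} f : rename.

Definition functor_id (C : Category) : Functor C C :=
  {| fob := fun A => A; fmap := fun A B f => f;
     fmap1 := fun A => eq_refl; fmapM := fun A B E g f => eq_refl |}.

Lemma functor_comp_1 (C D E : Category) (G : Functor D E) (F : Functor C D)
  (A : C) : fmap G (fmap F (idm A)) = idm (G (F A)).
Proof. by rewrite !fmap1. Qed.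

Lemma functor_comp_M (C D E : Category) (G : Functor D E) (F : Functor C D)
  (X Y Z : C) (g : Hom Y Z) (f : Hom X Y) :
  fmap G (fmap F (g ∘ f)) = fmap G (fmap F g) ∘ fmap G (fmap F f).
Proof. by rewrite !fmapM. Qed.

Definition functor_comp (C D E : Category) (G : Functor D E) (F : Functor C D) :
  Functor C E :=
  {| fob := fun A => G (F A); fmap := fun A B f => fmap G (fmap F f);
     fmap1 := functor_comp_1 G F; fmapM := functor_comp_M G F |}.

Notation "G ⊚ F" := (functor_comp G F) (at level 40, left associativity)
  : cat_scope.

Record NatTrans (C D : Category) (F G : Functor C D) : Type := {
  ncomp :> forall A : C, Hom (F A) (G A);
  naturality : forall (A B : C) (f : Hom A B),
    ncomp B ∘ fmap F f = fmap G f ∘ ncomp A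
}.

Definition nat_invertible (C D : Category) (F G : Functor C D)
  (alpha : NatTrans F G) : Prop :=
  exists beta : NatTrans G F,
    forall A : C, beta A ∘ alpha A = idm (F A) /\ alpha A ∘ beta A = idm (G A).

Record Adjunction (C D : Category) (F : Functor C D) (G : Functor D C) : Type := {
  adj_unit : NatTrans (functor_id C) (G ⊚ F);
  adj_counit : NatTrans (F ⊚ G) (functor_id D);
  adj_triangleL : forall A : C,
    adj_counit (F A) ∘ fmap F (adj_unit A) = idm (F A);
  adj_triangleR : forall B : D,
    fmap G (adj_counit B) ∘ adj_unit (G B) = idm (G B)
}.

Definition adjunct (C D : Category) (F : Functor C D) (G : Functor D C)
  (adj : Adjunction F G) (A : C) (B : D) (k : Hom (F A) B) : Hom A (G B) :=
  fmap G k ∘ adj_unit adj A.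

Record RightAdjoint (C D : Category) (F : Functor C D) : Type := {
  radj :> Functor D C;
  radj_adj : Adjunction F radj
}.

Definition counit_of (C D : Category) (F : Functor C D) (R : RightAdjoint F)
  (B : D) : Hom (F (R B)) B := adj_counit (radj_adj R) B.

Definition adjunct_of (C D : Category) (F : Functor C D) (R : RightAdjoint F)
  (A : C) (B : D) (k : Hom (F A) B) : Hom A (R B) := adjunct (radj_adj R) k.

Lemma adjunct_ofK (C D : Category) (F : Functor C D) (R : RightAdjoint F)
  (A : C) (B : D) (k : Hom (F A) B) :
  counit_of R B ∘ fmap F (adjunct_of R k) = k.
Proof.
rewrite /counit_of /adjunct_of /adjunct fmapM compA.
have /= -> := naturality (adj_counit (radj_adj R)) k.
by rewrite -compA adj_triangleL compm1.
Qed.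

Lemma adjunct_of_uniq (C D : Category) (F : Functor C D) (R : RightAdjoint F)
  (A : C) (B : D) (n : Hom A (R B)) :
  adjunct_of R (counit_of R B ∘ fmap F n) = n.
Proof.
rewrite /counit_of /adjunct_of /adjunct fmapM -compA.
have /= <- := naturality (adj_unit (radj_adj R)) n.
by rewrite compA adj_triangleR comp1m.
Qed.

Section RightAdjointOfUniversal.

Variables (C D : Category) (F : Functor C D) (G : D -> C).
Variable eps : forall B, Hom (F (G B)) B.
Variable tr : forall (A : C) (B : D), Hom (F A) B -> Hom A (G B).
Hypothesis trK : forall A B (k : Hom (F A) B), eps B ∘ fmap F (tr k) = k.
Hypothesis tr_uniq : forall A B (n : Hom A (G B)), tr (eps B ∘ fmap F n) = n.

Lemma universal_inj A B (n n' : Hom A (G B)) :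
  eps B ∘ fmap F n = eps B ∘ fmap F n' -> n = n'.
Proof. by move=> e; rewrite -(tr_uniq n) e tr_uniq. Qed.

Definition ru_map (A B : D) (k : Hom A B) : Hom (G A) (G B) := tr (k ∘ eps A).

Lemma ru_map1 (A : D) : ru_map (idm A) = idm (G A).
Proof. by apply: universal_inj; rewrite trK fmap1 comp1m compm1. Qed.

Lemma ru_mapM (X Y Z : D) (g : Hom Y Z) (f : Hom X Y) :
  ru_map (g ∘ f) = ru_map g ∘ ru_map f.
Proof.
apply: universal_inj.
by rewrite trK fmapM compA trK -[in RHS]compA trK compA.
Qed.

Definition ru_functor : Functor D C :=
  {| fob := G; fmap := ru_map; fmap1 := ru_map1; fmapM := ru_mapM |}.

Lemma ru_counit_nat (A B : D) (k : Hom A B) :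
  eps B ∘ fmap (F ⊚ ru_functor) k = fmap (functor_id D) k ∘ eps A.
Proof. exact: trK. Qed.

Definition ru_counit : NatTrans (F ⊚ ru_functor) (functor_id D) :=
  @Build_NatTrans D D (F ⊚ ru_functor) (functor_id D) eps ru_counit_nat.

Lemma ru_unit_nat (A B : C) (f : Hom A B) :
  tr (idm (F B)) ∘ fmap (functor_id C) f
  = fmap (ru_functor ⊚ F) f ∘ tr (idm (F A)).
Proof.
apply: universal_inj => /=.
rewrite !fmapM !compA trK /ru_map trK -compA trK.
by rewrite comp1m compm1.
Qed.

Definition ru_unit : NatTrans (functor_id C) (ru_functor ⊚ F) :=
  @Build_NatTrans C C (functor_id C) (ru_functor ⊚ F)
    (fun A => tr (idm (F A))) ru_unit_nat.

Lemma ru_triangleR (B : D) :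
  fmap ru_functor (ru_counit B) ∘ ru_unit (ru_functor B) = idm (ru_functor B).
Proof.
apply: universal_inj => /=.
by rewrite fmapM compA trK -compA trK fmap1.
Qed.

Definition right_adjoint_of_universal : RightAdjoint F :=
  {| radj := ru_functor;
     radj_adj := {| adj_unit := ru_unit; adj_counit := ru_counit;
                    adj_triangleL := fun A => trK (idm (F A));
                    adj_triangleR := ru_triangleR |} |}.

End RightAdjointOfUniversal.

Section Slices.

Variable C : Category.

Record SliceOb (X : C) : Type := SliceObMk {
  so_dom : C;
  so_map :> Hom so_dom X
}.

Record SliceHom (X : C) (a b : SliceOb X) : Type := SliceHomMk {
  sm_map :> Hom (so_dom a) (so_dom b);
  sm_comm : so_map b ∘ sm_map = so_map a
}.

Lemma slice_hom_eq (X : C) (a b : SliceOb X) (k l : SliceHom a b) :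
  sm_map k = sm_map l -> k = l.
Proof.
case: k l => [k ek] [l el] /= e; case: _ / e el => el.
by rewrite (proof_irrelevance _ ek el).
Qed.

Definition slice_id (X : C) (a : SliceOb X) : SliceHom a a :=
  {| sm_map := idm (so_dom a); sm_comm := compm1 (so_map a) |}.

Lemma slice_comp_comm (X : C) (a b c : SliceOb X)
  (l : SliceHom b c) (k : SliceHom a b) :
  so_map c ∘ (sm_map l ∘ sm_map k) = so_map a.
Proof. by rewrite compA !sm_comm. Qed.

Definition slice_comp (X : C) (a b c : SliceOb X)
  (l : SliceHom b c) (k : SliceHom a b) : SliceHom a c :=
  {| sm_map := sm_map l ∘ sm_map k; sm_comm := slice_comp_comm l k |}.

Lemma slice_comp1m (X : C) (a b : SliceOb X) (k : SliceHom a b) :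
  slice_comp (slice_id b) k = k.
Proof. by apply: slice_hom_eq; rewrite /= comp1m. Qed.

Lemma slice_compm1 (X : C) (a b : SliceOb X) (k : SliceHom a b) :
  slice_comp k (slice_id a) = k.
Proof. by apply: slice_hom_eq; rewrite /= compm1. Qed.

Lemma slice_compA (X : C) (a b c d : SliceOb X)
  (m : SliceHom c d) (l : SliceHom b c) (k : SliceHom a b) :
  slice_comp m (slice_comp l k) = slice_comp (slice_comp m l) k.
Proof. by apply: slice_hom_eq; rewrite /= compA. Qed.

Definition slice (X : C) : Category :=
  {| Ob := SliceOb X; Hom := @SliceHom X; idm := @slice_id X;
     comp := @slice_comp X; comp1m := @slice_comp1m X;
     compm1 := @slice_compm1 X; compA := @slice_compA X |}.

Definition sigma_ob (X Y : C) (f : Hom X Y) (a : slice X) : slice Y :=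
  {| so_dom := so_dom a; so_map := f ∘ so_map a |}.

Lemma sigma_comm (X Y : C) (f : Hom X Y) (a b : slice X) (k : Hom a b) :
  f ∘ so_map b ∘ sm_map k = f ∘ so_map a.
Proof. by rewrite -compA sm_comm. Qed.

Definition sigma_map (X Y : C) (f : Hom X Y) (a b : slice X) (k : Hom a b) :
  Hom (sigma_ob f a) (sigma_ob f b) :=
  @SliceHomMk Y (sigma_ob f a) (sigma_ob f b) (sm_map k) (sigma_comm f k).

Lemma sigma_map1 (X Y : C) (f : Hom X Y) (a : slice X) :
  sigma_map f (idm a) = idm (sigma_ob f a).
Proof. exact: slice_hom_eq. Qed.

Lemma sigma_mapM (X Y : C) (f : Hom X Y) (a b c : slice X)
  (l : Hom b c) (k : Hom a b) :
  sigma_map f (l ∘ k) = sigma_map f l ∘ sigma_map f k.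
Proof. exact: slice_hom_eq. Qed.

Definition Sigma (X Y : C) (f : Hom X Y) : Functor (slice X) (slice Y) :=
  {| fob := sigma_ob f; fmap := @sigma_map X Y f;
     fmap1 := sigma_map1 f; fmapM := @sigma_mapM X Y f |}.

Record Pullback (A B X : C) (f : Hom A X) (g : Hom B X) : Type := {
  pb_ob : C;
  pb1 : Hom pb_ob A;
  pb2 : Hom pb_ob B;
  pb_comm : f ∘ pb1 = g ∘ pb2;
  pb_lift : forall (T : C) (a : Hom T A) (b : Hom T B),
    f ∘ a = g ∘ b -> Hom T pb_ob;
  pb_lift1 : forall (T : C) (a : Hom T A) (b : Hom T B) (e : f ∘ a = g ∘ b),
    pb1 ∘ pb_lift e = a;
  pb_lift2 : forall (T : C) (a : Hom T A) (b : Hom T B) (e : f ∘ a = g ∘ b),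
    pb2 ∘ pb_lift e = b;
  pb_uniq : forall (T : C) (u v : Hom T pb_ob),
    pb1 ∘ u = pb1 ∘ v -> pb2 ∘ u = pb2 ∘ v -> u = v
}.

Definition HasPullbacks : Type :=
  forall (A B X : C) (f : Hom A X) (g : Hom B X), Pullback f g.

Section Delta.

Variables (pb : HasPullbacks) (X Y : C) (f : Hom X Y).

Definition delta_ob (h : slice Y) : slice X :=
  {| so_dom := pb_ob (pb f (so_map h)); so_map := pb1 (pb f (so_map h)) |}.

Lemma delta_comm (h h' : slice Y) (k : Hom h h') :
  f ∘ pb1 (pb f (so_map h)) = so_map h' ∘ (sm_map k ∘ pb2 (pb f (so_map h))).
Proof. by rewrite compA sm_comm pb_comm. Qed.

Definition delta_map (h h' : slice Y) (k : Hom h h') :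
  Hom (delta_ob h) (delta_ob h') :=
  @SliceHomMk X (delta_ob h) (delta_ob h')
    (@pb_lift _ _ _ _ _ (pb f (so_map h')) _ _ _ (delta_comm k))
    (@pb_lift1 _ _ _ _ _ (pb f (so_map h')) _ _ _ (delta_comm k)).

Lemma delta_map1 (h : slice Y) : delta_map (idm h) = idm (delta_ob h).
Proof.
apply: slice_hom_eq; apply: (@pb_uniq _ _ _ _ _ (pb f (so_map h))) => /=.
  by rewrite pb_lift1 compm1.
by rewrite pb_lift2 comp1m compm1.
Qed.

Lemma delta_mapM (h h' h'' : slice Y) (l : Hom h' h'') (k : Hom h h') :
  delta_map (l ∘ k) = delta_map l ∘ delta_map k.
Proof.
apply: slice_hom_eq; apply: (@pb_uniq _ _ _ _ _ (pb f (so_map h''))) => /=.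
  by rewrite pb_lift1 compA !pb_lift1.
rewrite pb_lift2 compA pb_lift2 -!compA; congr (_ ∘ _).
by rewrite pb_lift2.
Qed.

Definition Delta : Functor (slice Y) (slice X) :=
  {| fob := delta_ob; fmap := delta_map;
     fmap1 := delta_map1; fmapM := delta_mapM |}.

End Delta.

Record Iso (A B : C) : Type := {
  iso_fwd :> Hom A B;
  iso_bwd : Hom B A;
  iso_bwdK : iso_bwd ∘ iso_fwd = idm A;
  iso_fwdK : iso_fwd ∘ iso_bwd = idm B
}.

Record SpanIso (A B P Q : C) (u : Hom P A) (v : Hom P B)
  (u' : Hom Q A) (v' : Hom Q B) : Type := {
  span_iso :> Iso P Q;
  span_iso1 : u' ∘ span_iso = u;
  span_iso2 : v' ∘ span_iso = v
}.

Lemma span_iso_bwd (A B P Q : C) (u : Hom P A) (v : Hom P B)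
  (u' : Hom Q A) (v' : Hom Q B) (i : SpanIso u v u' v') :
  u ∘ iso_bwd i = u' /\ v ∘ iso_bwd i = v'.
Proof.
case: i => i eu ev; rewrite [span_iso _]/=; move: eu ev => <- <-.
by rewrite -!compA iso_fwdK !compm1.
Qed.

Definition jointly_monic (A B P : C) (u : Hom P A) (v : Hom P B) : Prop :=
  forall (T : C) (s t : Hom T P), u ∘ s = u ∘ t -> v ∘ s = v ∘ t -> s = t.

(* This includes the equality of domain and codomain. *)
Inductive is_identity (A : C) : forall B : C, Hom A B -> Prop :=
| is_identity_idm : is_identity (idm A).

End Slices.

(* For f : A -> X and g : B -> X, [sc f g] is the apex A (x)_X B, and
   [sc1 f g], [sc2 f g] are its projections to A (written g') and to B
   (written f').  The isomorphisms required by symmetry and by pasting are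
   unique, by joint monicity, so recording them as data is harmless. *)
Record LocSubcartesian : Type := {
  lsc_cat :> Category;
  sc : forall A B X : lsc_cat, Hom A X -> Hom B X -> lsc_cat;
  sc1 : forall (A B X : lsc_cat) (f : Hom A X) (g : Hom B X), Hom (sc f g) A;
  sc2 : forall (A B X : lsc_cat) (f : Hom A X) (g : Hom B X), Hom (sc f g) B;
  sc_comm : forall (A B X : lsc_cat) (f : Hom A X) (g : Hom B X),
    f ∘ sc1 f g = g ∘ sc2 f g;
  sc_monic : forall (A B X : lsc_cat) (f : Hom A X) (g : Hom B X),
    jointly_monic (sc1 f g) (sc2 f g);
  sc_sym : forall (A B X : lsc_cat) (f : Hom A X) (g : Hom B X),
    SpanIso (sc1 f g) (sc2 f g) (sc2 g f) (sc1 g f);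
  sc_nullary : forall (A B X : lsc_cat) (f : Hom A X) (g : Hom B X),
    is_identity g -> is_identity (sc1 f g);
  sc_binary : forall (W Y Z B : lsc_cat)
      (p : Hom W Y) (q : Hom Y Z) (g : Hom B Z),
    SpanIso (sc1 p (sc1 q g)) (sc2 q g ∘ sc2 p (sc1 q g))
            (sc1 (q ∘ p) g) (sc2 (q ∘ p) g)
}.

(* u : P -> A and v : P -> B form a subpullback of f : A -> X, g : B -> X. *)
Definition is_subpullback (E : LocSubcartesian) (A B X P : E)
  (f : Hom A X) (g : Hom B X) (u : Hom P A) (v : Hom P B) : Prop :=
  f ∘ u = g ∘ v /\ inhabited (SpanIso u v (sc1 f g) (sc2 f g)).

Section Nabla.

Variables (E : LocSubcartesian) (X Y : E) (f : Hom X Y).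

Definition nabla_ob (h : slice Y) : slice X :=
  {| so_dom := sc f (so_map h); so_map := sc1 f (so_map h) |}.

Lemma nabla_fun_comp (H H' : E) (h' : Hom H' Y) (k : Hom H H') :
  {t : Hom (sc f (h' ∘ k)) (sc f h') |
     sc1 f h' ∘ t = sc1 f (h' ∘ k) /\ sc2 f h' ∘ t = k ∘ sc2 f (h' ∘ k)}.
Proof.
pose b := sc_binary k h' f.
have [b1 b2] := span_iso_bwd b.
exists (sc_sym h' f ∘ sc2 k (sc1 h' f) ∘ iso_bwd b ∘ sc_sym f (h' ∘ k)); split.
  by rewrite !compA (span_iso2 (sc_sym h' f)) b2 (span_iso1 (sc_sym f _)).
rewrite !compA (span_iso1 (sc_sym h' f)) -(sc_comm k) -(compA k) b1.
by rewrite -compA (span_iso2 (sc_sym f _)).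
Qed.

Lemma nabla_fun (H H' : E) (h : Hom H Y) (h' : Hom H' Y) (k : Hom H H') :
  h' ∘ k = h ->
  {t : Hom (sc f h) (sc f h') |
     sc1 f h' ∘ t = sc1 f h /\ sc2 f h' ∘ t = k ∘ sc2 f h}.
Proof. move=> <-; exact: nabla_fun_comp. Qed.

(* The unique morphism compatible with the projections. *)
Definition nabla_map (h h' : slice Y) (k : Hom h h') :
  Hom (nabla_ob h) (nabla_ob h') :=
  let t := nabla_fun (sm_comm k) in
  @SliceHomMk E X (nabla_ob h) (nabla_ob h')
    (proj1_sig t) (proj1 (proj2_sig t)).

Lemma nabla_map2 (h h' : slice Y) (k : Hom h h') :
  sc2 f (so_map h') ∘ sm_map (nabla_map k) = sm_map k ∘ sc2 f (so_map h).
Proof. exact: (proj2 (proj2_sig (nabla_fun (sm_comm k)))). Qed.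

Lemma nabla_inj (h h' : slice Y) (s t : Hom (nabla_ob h) (nabla_ob h')) :
  sc2 f (so_map h') ∘ sm_map s = sc2 f (so_map h') ∘ sm_map t -> s = t.
Proof.
move=> e; apply: slice_hom_eq; apply: sc_monic e.
by rewrite [LHS](sm_comm s) [RHS](sm_comm t).
Qed.

Lemma nabla_map1 (h : slice Y) : nabla_map (idm h) = idm (nabla_ob h).
Proof. by apply: nabla_inj; rewrite nabla_map2 /= comp1m compm1. Qed.

Lemma nabla_mapM (h h' h'' : slice Y) (l : Hom h' h'') (k : Hom h h') :
  nabla_map (l ∘ k) = nabla_map l ∘ nabla_map k.
Proof.
apply: nabla_inj; rewrite nabla_map2 [sm_map (_ ∘ nabla_map k)]/=.
by rewrite compA nabla_map2 -compA nabla_map2 compA.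
Qed.

Definition Nabla : Functor (slice Y) (slice X) :=
  {| fob := nabla_ob; fmap := nabla_map;
     fmap1 := nabla_map1; fmapM := nabla_mapM |}.

End Nabla.

(* The functor - (x)_X g on the slice over X. *)
Definition tensor_right (E : LocSubcartesian) (X : E) (g : slice X) :
  Functor (slice X) (slice X) := Sigma (so_map g) ⊚ Nabla (so_map g).

Record LocSubcartesianClosed : Type := {
  lscc_lsc :> LocSubcartesian;
  lscc_pullbacks : HasPullbacks lscc_lsc;
  lscc_closed : forall (X : lscc_lsc) (g : slice X),
    RightAdjoint (tensor_right g)
}.

(* The right adjoint of [Nabla p], obtained from the right adjoint R of
   - (x)_Y p.  The projections X (x)_Y U -> X are maps u (x)_Y p -> p over Y,
   hence have adjuncts u -> R p, and k : K -> X is sent to the pullback of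
   R k : R (p k) -> R p along the adjunct of the identity of Y. *)
Section Box.

Variables (E : LocSubcartesianClosed) (X Y : E) (p : Hom X Y).

Let pY : slice Y := @SliceObMk E Y X p.
Let one : slice Y := @SliceObMk E Y Y (idm Y).
Let T : Functor (slice Y) (slice Y) := tensor_right pY.
Let R : RightAdjoint T := lscc_closed pY.

Let over (k : slice X) : Hom (Sigma p k) pY :=
  @SliceHomMk E Y (Sigma p k) pY (so_map k) eq_refl.

Let theta (u : slice Y) : Hom u (R pY) := adjunct_of R (over (Nabla p u)).

Lemma adjunct_nat (u v : slice Y) (w : slice Y) (k : Hom (T v) w) (l : Hom u v) :
  adjunct_of R (k ∘ fmap T l) = adjunct_of R k ∘ l.
Proof.
rewrite -[RHS](@adjunct_of_uniq _ _ _ R) fmapM compA.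
by rewrite adjunct_ofK.
Qed.

Lemma theta_nat (u v : slice Y) (l : Hom u v) : theta v ∘ l = theta u.
Proof.
rewrite /theta -adjunct_nat; congr (adjunct_of _ _).
apply: slice_hom_eq; exact: (sm_comm (fmap (Nabla p) l)).
Qed.

Let bang (u : slice Y) : Hom u one :=
  @SliceHomMk E Y u one (so_map u) (comp1m (so_map u)).

Let box_pb (k : slice X) :=
  lscc_pullbacks (sm_map (theta one)) (sm_map (fmap R (over k))).

Definition box_ob (k : slice X) : slice Y :=
  {| so_dom := pb_ob (box_pb k); so_map := pb1 (box_pb k) |}.

Lemma box_pr_comm (k : slice X) :
  so_map (R (Sigma p k)) ∘ pb2 (box_pb k) = pb1 (box_pb k).
Proof.
have e1 : so_map (R pY) ∘ sm_map (theta one) = idm Y := sm_comm (theta one).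
have e2 : so_map (R pY) ∘ sm_map (fmap R (over k)) = so_map (R (Sigma p k)).
  exact: (sm_comm (fmap R (over k))).
by rewrite -e2 -compA -pb_comm compA e1 comp1m.
Qed.

Let box_pr (k : slice X) : Hom (box_ob k) (R (Sigma p k)) :=
  @SliceHomMk E Y (box_ob k) (R (Sigma p k)) (pb2 (box_pb k)) (box_pr_comm k).

Lemma box_pr_over (k : slice X) :
  fmap R (over k) ∘ box_pr k = theta (box_ob k).
Proof.
rewrite -(theta_nat (bang (box_ob k))); apply: slice_hom_eq.
by rewrite /= pb_comm.
Qed.

Lemma over_counit (k : slice X) (u : slice Y) (n : Hom u (R (Sigma p k))) :
  fmap R (over k) ∘ n = theta u ->
  over k ∘ (counit_of R (Sigma p k) ∘ fmap T n) = over (Nabla p u).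
Proof.
move=> e; rewrite -[RHS](@adjunct_ofK _ _ _ R) -/(theta u) -e fmapM !compA.
congr (_ ∘ _).
by have /= -> := naturality (adj_counit (radj_adj R)) (over k).
Qed.

Lemma box_counit_comm (k : slice X) :
  so_map k ∘ sm_map (counit_of R (Sigma p k) ∘ fmap T (box_pr k))
  = so_map (Nabla p (box_ob k)).
Proof. exact: (f_equal (@sm_map _ _ _ _) (over_counit (box_pr_over k))). Qed.

Definition box_counit (k : slice X) : Hom (Nabla p (box_ob k)) k :=
  @SliceHomMk E X (Nabla p (box_ob k)) k
    (sm_map (counit_of R (Sigma p k) ∘ fmap T (box_pr k)))
    (box_counit_comm k).

Lemma box_tr_eq (u : slice Y) (k : slice X) (m : Hom (Nabla p u) k) :
  sm_map (theta one) ∘ so_map u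
  = sm_map (fmap R (over k)) ∘ sm_map (adjunct_of R (fmap (Sigma p) m)).
Proof.
have -> : sm_map (theta one) ∘ so_map u = sm_map (theta u).
  by rewrite -(theta_nat (bang u)).
have -> : theta u = fmap R (over k) ∘ adjunct_of R (fmap (Sigma p) m).
  rewrite /adjunct_of /adjunct compA -fmapM /theta.
  congr (fmap R _ ∘ _).
  apply: slice_hom_eq; exact: (eq_sym (sm_comm m)).
by [].
Qed.

Definition box_tr (u : slice Y) (k : slice X) (m : Hom (Nabla p u) k) :
  Hom u (box_ob k) :=
  @SliceHomMk E Y u (box_ob k)
    (@pb_lift _ _ _ _ _ _ (box_pb k) _ _ _ (box_tr_eq m))
    (@pb_lift1 _ _ _ _ _ _ (box_pb k) _ _ _ (box_tr_eq m)).

Lemma box_pr_tr (u : slice Y) (k : slice X) (m : Hom (Nabla p u) k) :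
  box_pr k ∘ box_tr m = adjunct_of R (fmap (Sigma p) m).
Proof. by apply: slice_hom_eq; rewrite /= pb_lift2. Qed.

Lemma sigma_box_counit (u : slice Y) (k : slice X) (n : Hom u (box_ob k)) :
  fmap (Sigma p) (box_counit k ∘ fmap (Nabla p) n)
  = counit_of R (Sigma p k) ∘ fmap T (box_pr k ∘ n).
Proof. by rewrite [fmap T (_ ∘ _)]fmapM compA; apply: slice_hom_eq. Qed.

Lemma box_trK (u : slice Y) (k : slice X) (m : Hom (Nabla p u) k) :
  box_counit k ∘ fmap (Nabla p) (box_tr m) = m.
Proof.
apply: slice_hom_eq.
have := sigma_box_counit (box_tr m); rewrite box_pr_tr adjunct_ofK => e.
exact: (f_equal (@sm_map _ _ _ _) e).
Qed.

Lemma box_tr_uniq (u : slice Y) (k : slice X) (n : Hom u (box_ob k)) :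
  box_tr (box_counit k ∘ fmap (Nabla p) n) = n.
Proof.
apply: slice_hom_eq; apply: (@pb_uniq _ _ _ _ _ _ (box_pb k)).
  by rewrite [LHS](sm_comm (box_tr _)) [RHS](sm_comm n).
have := box_pr_tr (box_counit k ∘ fmap (Nabla p) n).
rewrite sigma_box_counit adjunct_of_uniq => e.
exact: (f_equal (@sm_map _ _ _ _) e).
Qed.

Definition Box : RightAdjoint (Nabla p) :=
  right_adjoint_of_universal box_trK box_tr_uniq.

End Box.

Definition is_distributivity_subpullback (E : LocSubcartesian)
  (S A E0 D B : E) (f : Hom A E0) (p : Hom E0 B)
  (e : Hom S A) (p' : Hom S D) (d : Hom D B) : Prop :=
  is_subpullback p d (f ∘ e) p' /\
  forall (L M : E) (h : Hom L A) (s : Hom L M) (v : Hom M B),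
    is_subpullback p v (f ∘ h) s ->
    exists! xy : Hom L S * Hom M D,
      e ∘ fst xy = h /\ d ∘ snd xy = v /\ p' ∘ fst xy = snd xy ∘ s.

Section CanonicalTransformation.

Variables (E : LocSubcartesianClosed) (S A E0 D B : E).
Variables (e : Hom S A) (f : Hom A E0) (p : Hom E0 B).
Variables (p' : Hom S D) (d : Hom D B).

Local Notation Δ := (Delta (@lscc_pullbacks E)).

Definition frakd_dom : Functor (slice A) (slice B) :=
  Sigma d ⊚ Box p' ⊚ Δ e.

Definition frakd_cod : Functor (slice A) (slice B) := Box p ⊚ Sigma f.

Definition frakd_m (h : slice A) : slice D :=
  Box p' (Δ e h).

(* The isomorphisms of E0 (x)_B M with S (x)_D M that are compatible with the
   projections to E0 and M, the projection of S (x)_D M to E0 being taken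
   through f e : S -> E0.  The one given by pasting is the only one. *)
Definition frakd_pasting (h : slice A) : Type :=
  let m := so_map (frakd_m h) in
  SpanIso (sc1 p (d ∘ m)) (sc2 p (d ∘ m)) (f ∘ e ∘ sc1 p' m) (sc2 p' m).

Lemma frakd_composite_comm (h : slice A) (i : frakd_pasting h) :
  f ∘ so_map h ∘ (pb2 (lscc_pullbacks e (so_map h))
     ∘ sm_map (counit_of (Box p') (Δ e h)) ∘ i)
  = sc1 p (d ∘ so_map (frakd_m h)).
Proof.
have c := sm_comm (counit_of (Box p') (Δ e h)).
rewrite -[RHS](span_iso1 i); move: (iso_fwd i) => j; rewrite -[sc1 p' _]c.
move: (sm_map (counit_of (Box p') (Δ e h))) => w.
rewrite !compA -(compA f (so_map h)) -(compA f e).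
by congr (f ∘ _ ∘ w ∘ j); rewrite [RHS]pb_comm.
Qed.

(* E0 (x)_B M ~ S (x)_D M -> S x_A R -> R, over E0. *)
Definition frakd_composite (h : slice A) (i : frakd_pasting h) :
  Hom (Nabla p (frakd_dom h)) (Sigma f h) :=
  @SliceHomMk E E0 (Nabla p (frakd_dom h)) (Sigma f h)
    (pb2 (lscc_pullbacks e (so_map h))
     ∘ sm_map (counit_of (Box p') (Δ e h)) ∘ i)
    (frakd_composite_comm i).

Definition is_canonical (delta : NatTrans frakd_dom frakd_cod) : Prop :=
  forall h : slice A, exists i : frakd_pasting h,
    delta h = adjunct_of (Box p) (frakd_composite i).

End CanonicalTransformation.

(* Main.v *)
(* A morphism v -> Box_p (Sigma_f h) over B amounts to a morphism
   a : E0 (x)_B T -> R over E0, where v : T -> B and h : R -> A.  Pasting with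
   the given subpullback, a morphism v -> Sigma_d (Box_p' (Delta_e h)) amounts
   to such an a together with x : E0 (x)_B T -> S and y : T -> D forming a
   morphism of subpullbacks over f with e x = h a; composition with frakd
   forgets (x, y).  Hence frakd is invertible exactly when (x, y) always exists
   and is unique, which is the terminality of the given subpullback. *)
From Stdlib Require Import ssreflect IndefiniteDescription.
Require Import Defs.

Set Implicit Arguments.
Unset Strict Implicit.
Unset Printing Implicit Defensive.

(** * Joint monicity, adjuncts and pointwise invertibility *)

Lemma jointly_monic_span_iso (C : Category) (A B P Q : C)
  (u : Hom P A) (v : Hom P B) (u' : Hom Q A) (v' : Hom Q B) :
  SpanIso u v u' v' -> jointly_monic u' v' -> jointly_monic u v.
Proof.
move=> i mono T s t eu ev.
rewrite -(comp1m s) -(comp1m t) -(iso_bwdK i) -!compA; congr (_ ∘ _).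
by apply: mono; rewrite !compA ?(span_iso1 i) ?(span_iso2 i).
Qed.

Lemma span_iso_of_maps (C : Category) (A B P Q : C)
  (u : Hom P A) (v : Hom P B) (u' : Hom Q A) (v' : Hom Q B)
  (s : Hom P Q) (t : Hom Q P) :
  jointly_monic u v -> jointly_monic u' v' ->
  u' ∘ s = u -> v' ∘ s = v -> u ∘ t = u' -> v ∘ t = v' -> SpanIso u v u' v'.
Proof.
move=> mono mono' su sv tu tv.
have ts : t ∘ s = idm P by apply: mono; rewrite compA ?tu ?tv compm1.
have st : s ∘ t = idm Q by apply: mono'; rewrite compA ?su ?sv compm1.
by exists (Build_Iso ts st).
Qed.

Lemma adjunct_of_inj (C D : Category) (F : Functor C D) (R : RightAdjoint F)
  (X : C) (Y : D) (k l : Hom X (R Y)) :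
  counit_of R Y ∘ fmap F k = counit_of R Y ∘ fmap F l -> k = l.
Proof. by move=> e; rewrite -(adjunct_of_uniq k) e adjunct_of_uniq. Qed.

Lemma counit_of_nat (C D : Category) (F : Functor C D) (R : RightAdjoint F)
  (X Y : D) (k : Hom X Y) :
  counit_of R Y ∘ fmap F (fmap R k) = k ∘ counit_of R X.
Proof. exact: (naturality (adj_counit (radj_adj R)) k). Qed.

(** The inverses are given by mere existence, so a choice principle assembles them into a family;
    its naturality is automatic. *)
Lemma nat_invertible_pointwise (C D : Category) (F G : Functor C D)
  (alpha : NatTrans F G) :
  (forall A, exists beta : Hom (G A) (F A),
     beta ∘ alpha A = idm _ /\ alpha A ∘ beta = idm _) ->
  nat_invertible alpha.
Proof.
move=> inv'.
pose beta A := proj1_sig (constructive_indefinite_description _ (inv' A)).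
have inv A : beta A ∘ alpha A = idm _ /\ alpha A ∘ beta A = idm _.
  exact: (proj2_sig (constructive_indefinite_description _ (inv' A))).
have nat (A B : C) (f : Hom A B) : beta B ∘ fmap G f = fmap F f ∘ beta A.
  rewrite -[LHS]compm1 -(proj2 (inv A)) !compA -(compA (beta B)).
  by rewrite -naturality compA (proj1 (inv B)) comp1m.
by exists (@Build_NatTrans _ _ G F beta nat).
Qed.

(** * Pasting with a given subpullback *)

Section Pasting.

Variables (E : LocSubcartesian) (S E0 D B : E).
Variables (q : Hom S E0) (p : Hom E0 B) (p' : Hom S D) (d : Hom D B).
Hypothesis sq : SpanIso q p' (sc1 p d) (sc2 p d).
Variables (T : E) (t : Hom T D).

(** [sc_binary] pastes chosen squares only, with the composite as first leg. Symmetry swaps the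
    legs, and [nabla_fun] trades the chosen square of [d] and [p] for the given one. *)
Lemma pasting_maps :
  {k : Hom (sc p (d ∘ t)) (sc p' t) & {l : Hom (sc p' t) (sc p (d ∘ t)) |
    (q ∘ sc1 p' t ∘ k = sc1 p (d ∘ t) /\ sc2 p' t ∘ k = sc2 p (d ∘ t)) /\
    (sc1 p (d ∘ t) ∘ l = q ∘ sc1 p' t /\ sc2 p (d ∘ t) ∘ l = sc2 p' t)}}.
Proof.
have [q1 q2] := span_iso_bwd sq.
pose b := sc_binary t d p; have [b1 b2] := span_iso_bwd b.
have f1 : p' ∘ (iso_bwd sq ∘ sc_sym d p) = sc1 d p.
  by rewrite compA q2 (span_iso1 (sc_sym d p)).
have f2 : sc1 d p ∘ (sc_sym p d ∘ sq) = p'.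
  by rewrite compA (span_iso2 (sc_sym p d)) (span_iso2 sq).
have [k [k1 k2]] := nabla_fun t f1.
have [l [l1 l2]] := nabla_fun t f2.
exists (sc_sym t p' ∘ k ∘ iso_bwd b ∘ sc_sym p (d ∘ t)).
exists (sc_sym (d ∘ t) p ∘ b ∘ l ∘ sc_sym p' t); split; split.
- rewrite !compA -(compA q) (span_iso2 (sc_sym t p')) -(compA q) k2 !compA.
  rewrite q1 (span_iso2 (sc_sym d p)) b2.
  exact: (span_iso1 (sc_sym p (d ∘ t))).
- rewrite !compA (span_iso1 (sc_sym t p')) k1 b1.
  exact: (span_iso2 (sc_sym p (d ∘ t))).
- rewrite !compA (span_iso2 (sc_sym (d ∘ t) p)) (span_iso2 b).
  rewrite -(compA (sc2 d p)) l2 !compA (span_iso1 (sc_sym p d)) (span_iso1 sq).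
  by rewrite -compA (span_iso1 (sc_sym p' t)).
- rewrite !compA (span_iso1 (sc_sym (d ∘ t) p)) (span_iso1 b) l1.
  exact: (span_iso2 (sc_sym p' t)).
Qed.

(** The projection to [T] fixes the composite [p' ∘ sc1 p' t] into [D]; as [q] and [p'] are jointly
    monic, the projection to [S] is then fixed too. *)
Lemma pasting_monic : jointly_monic (q ∘ sc1 p' t) (sc2 p' t).
Proof.
have mono := jointly_monic_span_iso sq (@sc_monic E _ _ _ p d).
move=> X a b e1 e2; apply: sc_monic => //; apply: mono; rewrite !compA //.
by rewrite (sc_comm p' t) -!compA e2.
Qed.

Lemma pasting :
  SpanIso (sc1 p (d ∘ t)) (sc2 p (d ∘ t)) (q ∘ sc1 p' t) (sc2 p' t).
Proof.
have [k [l [[k1 k2] [l1 l2]]]] := pasting_maps.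
exact: span_iso_of_maps (@sc_monic E _ _ _ _ _) pasting_monic k1 k2 l1 l2.
Qed.

End Pasting.

(** * The canonical transformation and its naturality *)

Section Canonical.

Variables (E : LocSubcartesianClosed) (S A E0 D B : E).
Variables (e : Hom S A) (f : Hom A E0) (p : Hom E0 B) (p' : Hom S D) (d : Hom D B).
Hypothesis sq : SpanIso (f ∘ e) p' (sc1 p d) (sc2 p d).

Local Notation Δ := (Delta (@lscc_pullbacks E)).
Local Notation dom := (frakd_dom e p' d).
Local Notation cod := (frakd_cod f p).

Let paste (u : slice D) := pasting sq (so_map u).
Let eps' (h : slice A) := counit_of (Box p') (Δ e h).
Let eps (h : slice A) := counit_of (Box p) (Sigma f h).
Let pr (h : slice A) := lscc_pullbacks e (so_map h).

Definition canonical_composite (h : slice A) : Hom (Nabla p (dom h)) (Sigma f h) :=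
  frakd_composite (paste (frakd_m e p' h) : frakd_pasting e f p p' d h).

Lemma pasting_nat (u u' : slice D) (k : Hom u u') :
  paste u' ∘ sm_map (fmap (Nabla p) (fmap (Sigma d) k))
  = sm_map (fmap (Nabla p') k) ∘ paste u.
Proof.
apply: (pasting_monic sq); rewrite !compA.
  have c := sm_comm (fmap (Nabla p') k).
  rewrite (span_iso1 (paste u')) -(compA (f ∘ e)) [sc1 p' _ ∘ _]c.
  rewrite (span_iso1 (paste u)).
  exact: (sm_comm (fmap (Nabla p) (fmap (Sigma d) k))).
have n := nabla_map2 p (fmap (Sigma d) k).
have n' := nabla_map2 p' k.
rewrite (span_iso2 (paste u')) [LHS]n [sc2 p' _ ∘ _]n'.
by rewrite -(compA (sm_map k)) (span_iso2 (paste u)).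
Qed.

(** Naturality of pasting moves [k] past the isomorphism, which exposes its transpose
    [eps' h ∘ fmap (Nabla p') k] under the adjunction for [p']. *)
Lemma canonical_composite_nabla (h : slice A) (u : slice D)
  (k : Hom u (frakd_m e p' h)) :
  sm_map (canonical_composite h ∘ fmap (Nabla p) (fmap (Sigma d) k))
  = pb2 (pr h) ∘ sm_map (eps' h ∘ fmap (Nabla p') k) ∘ paste u.
Proof.
have /= nat := pasting_nat k.
by rewrite /= -(compA _ (iso_fwd _)) nat !compA.
Qed.

Definition canonical_ncomp (h : slice A) : Hom (dom h) (cod h) :=
  adjunct_of (Box p) (canonical_composite h).

Lemma canonical_ncompK (h : slice A) (v : slice B) (w : Hom v (dom h)) :
  eps h ∘ fmap (Nabla p) (canonical_ncomp h ∘ w)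
  = canonical_composite h ∘ fmap (Nabla p) w.
Proof. by rewrite fmapM compA /eps adjunct_ofK. Qed.

Lemma canonical_nat (h h' : slice A) (k : Hom h h') :
  canonical_ncomp h' ∘ fmap dom k = fmap cod k ∘ canonical_ncomp h.
Proof.
apply: (adjunct_of_inj (R := Box p)).
rewrite [LHS]canonical_ncompK [in RHS]fmapM [in RHS]compA.
have c := counit_of_nat (Box p) (fmap (Sigma f) k).
rewrite [_ ∘ fmap _ (fmap cod k)]c -[RHS]compA.
rewrite [X in _ = _ ∘ X](adjunct_ofK (Box p) (canonical_composite h)).
(* After transposing along [p], what remains is naturality of the counit for [p'] and of the
   pullback projection [pb2]. *)
apply: slice_hom_eq; rewrite [LHS]canonical_composite_nabla.
rewrite [eps' h' ∘ _](counit_of_nat (Box p') (fmap (Δ e) k)) /=.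
by rewrite !compA pb_lift2.
Qed.

Definition canonical_frakd : NatTrans dom cod :=
  @Build_NatTrans _ _ dom cod canonical_ncomp canonical_nat.

Lemma canonical_frakdP : is_canonical canonical_frakd.
Proof. by move=> h; exists (paste (frakd_m e p' h)). Qed.

(** * Maps into the domain of the transformation *)

(** A map into [Sigma d c] puts its source over [D] through [so_map c]. The form of an induction
    principle avoids transport along the equality of structure maps. *)
Lemma sigma_hom_ind (c : slice D)
  (P : forall v, Hom v (Sigma d c) -> Prop) :
  (forall (u : slice D) (k : Hom u c), P (Sigma d u) (fmap (Sigma d) k)) ->
  forall v (w : Hom v (Sigma d c)), P v w.
Proof.
move=> H [T v] [w /= ew].
have ev : d ∘ (so_map c ∘ w) = v by rewrite compA.
case: _ / ev ew => ew.
have := H (SliceObMk (so_map c ∘ w)) (@SliceHomMk _ _ (SliceObMk _) c w eq_refl).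
by congr (P _ _); apply: slice_hom_eq.
Qed.

(** Equal legs to [D] make both maps images under [Sigma d] of maps [k], [k'] with the same source.
    Their transposes land in a pullback: the first projections are both the structure map to [S],
    the second agree once the pasting isomorphism is cancelled. *)
Lemma canonical_separated (h : slice A) (v : slice B) (w w' : Hom v (dom h)) :
  so_map (frakd_m e p' h) ∘ sm_map w = so_map (frakd_m e p' h) ∘ sm_map w' ->
  canonical_ncomp h ∘ w = canonical_ncomp h ∘ w' -> w = w'.
Proof.
elim/sigma_hom_ind: v / w w' => u k w' em ew.
have ek' : so_map (frakd_m e p' h) ∘ sm_map w' = so_map u.
  by rewrite -em; apply: (sm_comm k).
pose k' : Hom u (frakd_m e p' h) :=
    @SliceHomMk E D u (frakd_m e p' h) (sm_map w') ek'.
have ew' : w' = fmap (Sigma d) k' by apply: slice_hom_eq.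
rewrite ew' in ew *; congr (fmap (Sigma d) _).
apply: (adjunct_of_inj (R := Box p')); apply: slice_hom_eq.
apply: (@pb_uniq _ _ _ _ _ _ (pr h)).
  by rewrite [LHS](sm_comm (eps' h ∘ fmap _ k)) [RHS](sm_comm (eps' h ∘ fmap _ k')).
have := canonical_composite_nabla k'.
rewrite -canonical_ncompK -ew canonical_ncompK canonical_composite_nabla => eq.
rewrite -[LHS]compm1 -[RHS]compm1 -(iso_fwdK (paste u)) [LHS]compA [RHS]compA.
by congr (_ ∘ _).
Qed.

(** [y] puts the source over [D], and pasting identifies [x] with the projection [sc1 p' y]. Then
    [x] and [a] induce a map to the pullback of [h] along [e], whose adjunct for [p'] gives the
    lift. *)
Lemma canonical_lift (h : slice A) (v : slice B)
  (a : Hom (Nabla p v) (Sigma f h))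
  (x : Hom (sc p (so_map v)) S) (y : Hom (so_dom v) D) :
  e ∘ x = so_map h ∘ sm_map a -> d ∘ y = so_map v ->
  p' ∘ x = y ∘ sc2 p (so_map v) ->
  {w : Hom v (dom h) | so_map (frakd_m e p' h) ∘ sm_map w = y /\
                       canonical_ncomp h ∘ w = adjunct_of (Box p) a}.
Proof.
case: v a x y => T v /= a x y ex ey; case: _ / ey a x ex => a x ex exy.
pose u : slice D := SliceObMk y; pose j := paste u.
have xj : sc1 p' y ∘ j = x.
  apply: (jointly_monic_span_iso sq (@sc_monic E _ _ _ p d)).
    rewrite compA (span_iso1 j) -compA ex compA; exact: (eq_sym (sm_comm a)).
  by rewrite compA sc_comm -compA (span_iso2 j).
have sqb : e ∘ sc1 p' y = so_map h ∘ (sm_map a ∘ iso_bwd j).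
  by rewrite compA -ex -xj -(compA e) -(compA (sc1 p' y)) iso_fwdK compm1.
pose b : Hom (Nabla p' u) (Δ e h) :=
  @SliceHomMk E S (Nabla p' u) (Δ e h) (pb_lift (pr h) sqb)
    (pb_lift1 (pr h) sqb).
pose k : Hom u (frakd_m e p' h) := adjunct_of (Box p') b.
exists (fmap (Sigma d) k); split; first exact: (sm_comm k).
apply: (adjunct_of_inj (R := Box p)); rewrite [LHS]canonical_ncompK adjunct_ofK.
apply: slice_hom_eq; apply: (eq_trans (canonical_composite_nabla k)).
rewrite /eps' adjunct_ofK.
by rewrite [sm_map b]/= pb_lift2 -(compA (sm_map a)) iso_bwdK compm1.
Qed.

(** Converse to [canonical_lift]: [x] is the projection to [S] after pasting, and the pullback
    square gives its equation over [A]. *)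
Lemma canonical_pair (h : slice A) (v : slice B) (w : Hom v (dom h)) :
  let y := so_map (frakd_m e p' h) ∘ sm_map w in
  exists x : Hom (sc p (so_map v)) S,
    e ∘ x = so_map h ∘ sm_map (eps h ∘ fmap (Nabla p) (canonical_ncomp h ∘ w)) /\
    d ∘ y = so_map v /\ p' ∘ x = y ∘ sc2 p (so_map v).
Proof.
elim/sigma_hom_ind: v / w => u k y; have -> : y = so_map u := sm_comm k.
exists (sc1 p' (so_map u) ∘ paste u); split; last split=> //.
  have c : pb1 (pr h) ∘ sm_map (eps' h ∘ fmap (Nabla p') k) = sc1 p' (so_map u).
    exact: (sm_comm (eps' h ∘ fmap (Nabla p') k)).
  rewrite canonical_ncompK canonical_composite_nabla.
  rewrite (compA e) 2!(compA (so_map h)) -(pb_comm (pr h)).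
  by rewrite -(compA e (pb1 (pr h))) c.
by rewrite compA sc_comm -compA (span_iso2 (paste u)).
Qed.

(** * Invertibility and terminality *)

(** As [a] is a map over [E0], the square is the chosen one; terminality can thus be applied to
    it. *)
Lemma slice_hom_subpullback (h : slice A) (v : slice B)
  (a : Hom (Nabla p v) (Sigma f h)) :
  is_subpullback p (so_map v) (f ∘ (so_map h ∘ sm_map a)) (sc2 p (so_map v)).
Proof.
have -> : f ∘ (so_map h ∘ sm_map a) = sc1 p (so_map v).
  by rewrite compA; exact: (sm_comm a).
split; [exact: sc_comm | constructor].
by apply: (span_iso_of_maps (s := idm _) (t := idm _));
  rewrite ?compm1 //; apply: sc_monic.
Qed.

(** Uniqueness in terminality makes each component monic, and existence provides a section; a monic
    split epimorphism is invertible. *)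
Lemma distributivity_invertible :
  is_distributivity_subpullback f p e p' d -> nat_invertible canonical_frakd.
Proof.
move=> [_ U]; apply: nat_invertible_pointwise => h.
have monic v (w w' : Hom v (dom h)) :
    canonical_ncomp h ∘ w = canonical_ncomp h ∘ w' -> w = w'.
  move=> ew; apply: (canonical_separated _ ew).
  have [x [ex [dy xy]]] := canonical_pair w.
  have [x' [ex' [dy' xy']]] := canonical_pair w'; rewrite -ew in ex'.
  have [xy0 [_ uniq]] := U _ _ _ _ _ (slice_hom_subpullback
    (eps h ∘ fmap (Nabla p) (canonical_ncomp h ∘ w))).
  have /= := f_equal snd (uniq (_, _) (conj ex (conj dy xy))).
  by have /= -> := f_equal snd (uniq (_, _) (conj ex' (conj dy' xy'))).
(* The counit is the transpose of the identity of [cod h], so lifting it yields the section. *)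
have [[x y] [[ex [dy xy]] _]] := U _ _ _ _ _ (slice_hom_subpullback (eps h)).
have [b [_ cb]] := canonical_lift (v := Box p (Sigma f h)) ex dy xy.
have {}cb : canonical_ncomp h ∘ b = idm (cod h).
  rewrite cb; apply: (adjunct_of_inj (R := Box p)).
  by rewrite adjunct_ofK fmap1 compm1.
exists b; split=> //; apply: monic.
by rewrite compA [_ ∘ b]cb comp1m compm1.
Qed.

Lemma invertible_distributivity :
  nat_invertible canonical_frakd -> is_distributivity_subpullback f p e p' d.
Proof.
move=> [beta inv].
have sq_comm : p ∘ (f ∘ e) = d ∘ p'.
  by rewrite -(span_iso1 sq) -{2}(span_iso2 sq) !compA sc_comm.
split; first by split.
move=> L M h s v [_ [i]]; have [i1 i2] := span_iso_bwd i.
pose H : slice A := SliceObMk h; pose V : slice B := SliceObMk v.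
(* The inverse of [i], from the chosen apex to [L], is a map over [E0]; [beta] lifts its adjunct,
   which yields [x] and [y]. *)
pose a : Hom (Nabla p V) (Sigma f H) :=
  @SliceHomMk E E0 (Nabla p V) (Sigma f H) (iso_bwd i) i1.
pose w := beta H ∘ adjunct_of (Box p) a.
have cw : canonical_ncomp H ∘ w = adjunct_of (Box p) a.
  by rewrite compA (proj2 (inv H)) comp1m.
have [x [ex [dy xy]]] := canonical_pair w.
rewrite cw /eps adjunct_ofK in ex.
set y := so_map (frakd_m e p' H) ∘ sm_map w in dy xy.
have exi : e ∘ (x ∘ i) = h by rewrite compA ex -compA iso_bwdK compm1.
have xyi : p' ∘ (x ∘ i) = y ∘ s.
  by rewrite compA xy -compA (span_iso2 i).
exists (x ∘ i, y); split=> [//|[x' y'] /= [ex' [dy' xy']]].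
have e1 : e ∘ (x' ∘ iso_bwd i) = so_map H ∘ sm_map a by rewrite compA ex'.
have e2 : p' ∘ (x' ∘ iso_bwd i) = y' ∘ sc2 p (so_map V).
  by rewrite compA xy' -compA i2.
(* A competing pair lifts to a [w'] with the same image as [w]; invertibility gives [w' = w], hence
   [y = y']. *)
have [w' [mw' cw']] := canonical_lift (v := V) (h := H) e1 dy' e2.
have ew : w' = w.
  by rewrite /w -cw' compA (proj1 (inv H)) comp1m.
have ey : y = y' by rewrite -mw' ew.
rewrite ey in xyi *; congr (_, _).
(* With equal maps to [D], the maps to [S] agree since [f ∘ e] and [p'] are jointly monic. *)
apply: (jointly_monic_span_iso sq (@sc_monic E _ _ _ p d)).
  by rewrite -!compA exi ex'.
by rewrite xyi xy'.
Qed.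

End Canonical.

Theorem corollary4p3p3
  (E : LocSubcartesianClosed) (S A E0 D B : E)
  (e : Hom S A) (f : Hom A E0) (p : Hom E0 B) (p' : Hom S D) (d : Hom D B)
  (sq : is_subpullback p d (f ∘ e) p') :
  exists frakd : NatTrans (Sigma d ⊚ Box p' ⊚ Delta (@lscc_pullbacks E) e)
                          (Box p ⊚ Sigma f),
    is_canonical frakd /\
    (nat_invertible frakd <-> is_distributivity_subpullback f p e p' d).
Proof.
case: sq => _ [i]; exists (canonical_frakd i); split.
  exact: canonical_frakdP.
split; [exact: invertible_distributivity | exact: distributivity_invertible].
Qed.
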